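(* Let $\Sigma$ be a signature and $\mathbf{K}$ a class of $\Sigma$-structures that is closed under subalgebras and isomorphisms. Then there is a functor $Co_{\mathbf{K}}:\Sigma\text{-Str}^{op}\to Ord$ associating to a $\Sigma$-structure $A$ the set of congruences $\theta$ on $A$ such that $A/\theta\in\mathbf{K}$ (ordered by inclusion), and to a homomorphism $f:A\to B$ the function $$Co_{\mathbf{K}}(f):Co_{\mathbf{K}}(B)\to Co_{\mathbf{K}}(A),\quad\theta\mapsto(f\times f)^{-1}(\theta)=\{\langle a,a'\rangle\mid\langle f(a),f(a')\rangle\in\theta\}.$$ Conversely, if $\mathbf{K}$ is a class of $\Sigma$-structures such that $Co_{\mathbf{K}}:\Sigma\text{-Str}^{op}\to Ord$, $A\mapsto\{\theta\text{ congruence on }A\mid A/\theta\in\mathbf{K}\}$, is a functor which on morphisms is given by $Co_{\mathbf{K}}(f)=(f\times f)^{-1}$, then $\mathbf{K}$ is closed under substructures.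
   Context: $\Sigma$-Str is the category of $\Sigma$-structures (algebras for a signature $\Sigma$ of finitary function symbols) and homomorphisms. $Ord$ is the category of partially ordered sets and order preserving maps.
   Formalization: In the converse, K is also assumed closed under isomorphisms; without this the claim fails literally, e.g. for K = {A} with A not itself of the form B/θ and having a proper substructure, where every Co_K(B) is empty. *)

(* Defs.v *)
From mathcomp Require Import all_boot.
From mathcomp Require Import boolp classical_sets.
From Stdlib Require Relation_Definitions.

Set Implicit Arguments.
Unset Strict Implicit.
Unset Printing Implicit Defensive.

Local Open Scope classical_set_scope.
Local Open Scope quotient_scope.

(** * Categories and functors *)

Record category := Category {
  Ob :> Type;
  Hom : Ob -> Ob -> Type;
  idm : forall a, Hom a a;
  comp : forall a b c, Hom b c -> Hom a b -> Hom a c;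
  comp1m : forall a b (f : Hom a b), comp (idm b) f = f;
  compm1 : forall a b (f : Hom a b), comp f (idm a) = f;
  compA : forall a b c d (h : Hom c d) (g : Hom b c) (f : Hom a b),
    comp h (comp g f) = comp (comp h g) f }.

Definition opposite (C : category) : category :=
  @Category C (fun a b => Hom b a) (@idm C)
    (fun a b c (g : Hom c b) (f : Hom b a) => comp f g)
    (fun a b f => compm1 f) (fun a b f => comp1m f)
    (fun a b c d h g f => esym (compA f g h)).

Record is_functor (C D : category) (F0 : C -> D)
    (F1 : forall a b : C, Hom a b -> Hom (F0 a) (F0 b)) : Prop := IsFunctor {
  functor_id : forall a, F1 a a (idm a) = idm (F0 a);
  functor_comp : forall a b c (g : Hom b c) (f : Hom a b),
    F1 a c (comp g f) = comp (F1 b c g) (F1 a b f) }.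

(** * The category of posets *)

Record poset := Poset {
  poset_sort :> Type;
  ple : Relation_Definitions.relation poset_sort;
  ple_order : Relation_Definitions.order poset_sort ple }.

Record monotone_map (P Q : poset) := MonotoneMap {
  monotone_fun :> P -> Q;
  monotoneP : forall x y, ple x y -> ple (monotone_fun x) (monotone_fun y) }.

Lemma monotone_map_eq (P Q : poset) (f g : monotone_map P Q) :
  f =1 g -> f = g.
Proof.
case: f g => [f fP] [g gP] /= /funext fg; subst g.
by congr MonotoneMap; exact: Prop_irrelevance.
Qed.

Definition monotone_id (P : poset) : monotone_map P P :=
  @MonotoneMap P P id (fun _ _ => id).

Definition monotone_comp (P Q S : poset)
    (g : monotone_map Q S) (f : monotone_map P Q) : monotone_map P S :=
  @MonotoneMap P S (g \o f) (fun x y xy => monotoneP g (monotoneP f xy)).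

Definition Ord : category.
Proof.
by refine (@Category poset monotone_map monotone_id monotone_comp _ _ _);
  move=> *; exact: monotone_map_eq.
Defined.

(** * The category of structures for a signature *)

Record signature := Signature {
  symbol : Type;
  arity : symbol -> nat }.

(* Carriers may be empty, as may the substructures below when the signature
   has no constant symbol. *)
Record structure (Sg : signature) := Structure {
  carrier :> Type;
  interp : forall s : symbol Sg, ('I_(arity s) -> carrier) -> carrier }.

Record homomorphism (Sg : signature) (A B : structure Sg) := Homomorphism {
  hom_fun :> A -> B;
  homP : forall (s : symbol Sg) (a : 'I_(arity s) -> A),
    hom_fun (interp a) = interp (hom_fun \o a) }.

Lemma homomorphism_eq (Sg : signature) (A B : structure Sg)
  (f g : homomorphism A B) : f =1 g -> f = g.
Proof.
case: f g => [f fP] [g gP] /= /funext fg; subst g.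
by congr Homomorphism; exact: Prop_irrelevance.
Qed.

Definition hom_id (Sg : signature) (A : structure Sg) : homomorphism A A :=
  @Homomorphism Sg A A id (fun _ _ => erefl).

Lemma hom_comp_subproof (Sg : signature) (A B C : structure Sg)
    (g : homomorphism B C) (f : homomorphism A B)
    (s : symbol Sg) (a : 'I_(arity s) -> A) :
  (g \o f) (interp a) = interp ((g \o f) \o a).
Proof. by rewrite /= !homP. Qed.

Definition hom_comp (Sg : signature) (A B C : structure Sg)
    (g : homomorphism B C) (f : homomorphism A B) : homomorphism A C :=
  Homomorphism (@hom_comp_subproof Sg A B C g f).

Definition Str (Sg : signature) : category.
Proof.
by refine (@Category (structure Sg) (@homomorphism Sg) (@hom_id Sg)
    (@hom_comp Sg) _ _ _); move=> *; exact: homomorphism_eq.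
Defined.

Definition isomorphic (Sg : signature) (A B : structure Sg) : Prop :=
  exists f : homomorphism A B, bijective f.

(** * Substructures *)

Definition subuniverse (Sg : signature) (A : structure Sg) (S : set A) : Prop :=
  forall (s : symbol Sg) (a : 'I_(arity s) -> A),
    (forall i, S (a i)) -> S (interp a).

Lemma substructure_subproof (Sg : signature) (A : structure Sg) (S : set A)
    (Ssub : subuniverse S) (s : symbol Sg) (a : 'I_(arity s) -> S) :
  interp (fun i => sval (a i)) \in S.
Proof. by apply/mem_set/Ssub => i; apply: set_mem; case: (a i). Qed.

Definition substructure (Sg : signature) (A : structure Sg) (S : set A)
    (Ssub : subuniverse S) : structure Sg :=
  @Structure Sg S
    (fun s a => exist (fun x => x \in S) (interp (fun i => sval (a i)))
                  (substructure_subproof Ssub a)).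

(** * Congruences and quotients *)

Record congruence (Sg : signature) (A : structure Sg) := Congruence {
  cong_set :> set (A * A);
  cong_equiv : Relation_Definitions.equivalence A (fun a a' => cong_set (a, a'));
  congP : forall (s : symbol Sg) (a a' : 'I_(arity s) -> A),
    (forall i, cong_set (a i, a' i)) -> cong_set (interp a, interp a') }.

Section Quotient.
Variables (Sg : signature) (A : structure Sg) (theta : congruence A).

Definition cong_rel : rel {classic A} := fun a a' : A => `[< cong_set theta (a, a') >].

Lemma cong_rel_refl : reflexive cong_rel.
Proof. by move=> a; apply/asboolP; case: (cong_equiv theta) => + _ _; exact. Qed.

Lemma cong_rel_sym : symmetric cong_rel.
Proof.
move=> a b; case: (cong_equiv theta) => _ _ thetaC.
by apply/asboolP/asboolP; exact: thetaC.
Qed.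

Lemma cong_rel_trans : transitive cong_rel.
Proof.
move=> b a c; case: (cong_equiv theta) => _ thetaT _.
by move=> /asboolP ab /asboolP bc; apply/asboolP; exact: thetaT ab bc.
Qed.

Definition cong_equiv_rel : equiv_rel {classic A} :=
  EquivRel cong_rel cong_rel_refl cong_rel_sym cong_rel_trans.

(* The choice of representatives is immaterial: see [quotient_proj_hom]. *)
Definition quotient : structure Sg :=
  @Structure Sg {eq_quot cong_equiv_rel}
    (fun s q => \pi_{eq_quot cong_equiv_rel} (@interp Sg A s (repr \o q))).

Definition quotient_proj : A -> quotient := \pi_{eq_quot cong_equiv_rel}.

Lemma quotient_projP (a a' : A) :
  quotient_proj a = quotient_proj a' <-> cong_set theta (a, a').
Proof.
by split => [/eqmodP/asboolP//|aa']; apply/eqmodP/asboolP.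
Qed.

Lemma quotient_proj_hom (s : symbol Sg) (a : 'I_(arity s) -> A) :
  quotient_proj (interp a) = interp (quotient_proj \o a).
Proof.
apply/quotient_projP/congP => i; apply/quotient_projP.
by rewrite /quotient_proj reprK.
Qed.

End Quotient.

(** * The assignment [Co_K] *)

Section Co.
Variables (Sg : signature) (K : structure Sg -> Prop).

Record Co_sort (A : structure Sg) := CoElt {
  Co_cong :> congruence A;
  Co_quotient : K (quotient Co_cong) }.

Definition Co_le (A : structure Sg) : Relation_Definitions.relation (Co_sort A) :=
  fun theta eta => theta `<=` eta.

Lemma Co_le_order (A : structure Sg) : Relation_Definitions.order (Co_sort A) (@Co_le A).
Proof.
split=> [theta|theta eta zeta|]; first exact: subset_refl.
  exact: subset_trans.
move=> [[t t1 t2] t3] [[e e1 e2] e3] te et.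
have {et}te : t = e by apply/seteqP; split.
subst e; have ? : t1 = e1 by exact: Prop_irrelevance.
have ? : t2 = e2 by exact: Prop_irrelevance.
by subst e1 e2; congr CoElt; exact: Prop_irrelevance.
Qed.

Definition Co_obj (A : structure Sg) : poset := Poset (@Co_le_order A).

(* A monotone map [Co_obj B -> Co_obj A] is determined by the underlying sets
   of its values, so that the second clause determines the action [F1]. *)
Definition Co_is_functor : Prop :=
  exists F1 : forall B A : opposite (Str Sg),
      @Hom (opposite (Str Sg)) B A -> @Hom Ord (Co_obj B) (Co_obj A),
    is_functor F1 /\
    forall (A B : structure Sg) (f : homomorphism A B) (theta : Co_obj B),
      (F1 B A f theta : set (A * A))
        = (fun p => (f p.1, f p.2)) @^-1` (theta : set (B * B)).

Definition closed_under_substructures : Prop :=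
  forall (A : structure Sg) (S : set A) (Ssub : subuniverse S),
    K A -> K (substructure Ssub).

Definition closed_under_isomorphisms : Prop :=
  forall A B : structure Sg, isomorphic A B -> K A -> K B.

End Co.

(* Main.v *)
Require Import Defs.
From mathcomp Require Import all_boot.
From mathcomp Require Import boolp classical_sets.

(** Everything rests on the homomorphism theorem. For [f : A -> B] and a
    congruence [theta] on [B], the preimage of [theta] is the kernel of
    [A -> B -> B / theta], so the quotient of [A] by it is isomorphic to a
    substructure of [B / theta]. Conversely, if [S] is a substructure of [A],
    the preimage of the equality of [A] under the inclusion is the equality of
    [S], and a quotient by equality is isomorphic to the structure itself. *)

Set Implicit Arguments.
Unset Strict Implicit.
Unset Printing Implicit Defensive.

Local Open Scope classical_set_scope.

Section Homomorphisms.
Variable Sg : signature.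
Implicit Types A B : structure Sg.

Lemma isomorphic_sym A B : isomorphic A B -> isomorphic B A.
Proof.
move=> [f [g fK gK]].
have gP (s : symbol Sg) (b : 'I_(arity s) -> B) :
    g (interp b) = interp (g \o b).
  apply: (can_inj fK); rewrite homP gK.
  by congr interp; apply/funext => i /=; rewrite gK.
by exists (Homomorphism gP); exists f.
Qed.

Definition quotient_hom A (theta : congruence A) :
    homomorphism A (quotient theta) :=
  Homomorphism (@quotient_proj_hom Sg A theta).

(** First isomorphism theorem for a surjection. The isomorphism is built from [B]: surjectivity
    supplies a chosen preimage of each element, and the kernel condition makes its class independent
    of the choice. *)
Lemma quotient_isomorphic A B (f : homomorphism A B) (theta : congruence A) :
    (forall b, exists a, f a = b) ->
    (forall a a', cong_set theta (a, a') <-> f a = f a') ->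
  isomorphic (quotient theta) B.
Proof.
move=> fsurj fker; apply: isomorphic_sym.
pose g b := sval (cid (fsurj b)).
have gK b : f (g b) = b by rewrite /g; case: cid.
have projg a : quotient_proj theta (g (f a)) = quotient_proj theta a.
  by apply/quotient_projP/fker; rewrite gK.
have hP (s : symbol Sg) (b : 'I_(arity s) -> B) :
    (quotient_proj theta \o g) (interp b)
      = interp ((quotient_proj theta \o g) \o b).
  (* Once the arguments are images under [f], [homP] moves the operation into [A], where [projg]
     cancels [g] against [f]. *)
  have -> : b = f \o (g \o b) by apply/funext => i /=; rewrite gK.
  rewrite -homP [LHS]/= projg quotient_proj_hom.
  by congr interp; apply/funext => i /=; rewrite projg.
exists (Homomorphism hP).
exists (fun q => f (generic_quotient.repr q)) => [b|q] /=.
  rewrite -[RHS]gK; apply/fker/quotient_projP.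
  by rewrite [LHS]/quotient_proj reprK.
by rewrite projg /quotient_proj reprK.
Qed.

Lemma preimage_cong_equiv A B (f : homomorphism A B) (theta : congruence B) :
  Relation_Definitions.equivalence A
    (fun a a' => ((fun p => (f p.1, f p.2)) @^-1` theta) (a, a')).
Proof.
by case: (cong_equiv theta) => r t s; split=> [a|a b c|a b] /=;
  [exact: r | exact: t | exact: s].
Qed.

Lemma preimage_congP A B (f : homomorphism A B) (theta : congruence B)
    (s : symbol Sg) (a a' : 'I_(arity s) -> A) :
    (forall i, ((fun p => (f p.1, f p.2)) @^-1` theta) (a i, a' i)) ->
  ((fun p => (f p.1, f p.2)) @^-1` theta) (interp a, interp a').
Proof. by move=> aa'; rewrite /preimage /= !homP; exact: congP. Qed.

Definition preimage_cong A B (f : homomorphism A B) (theta : congruence B) :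
    congruence A :=
  Congruence (preimage_cong_equiv f theta) (@preimage_congP A B f theta).

Lemma eq_cong_equiv A :
  Relation_Definitions.equivalence A
    (fun a a' => [set p : A * A | p.1 = p.2] (a, a')).
Proof. by split=> [a|a b c|a b] //= ->. Qed.

Lemma eq_congP A (s : symbol Sg) (a a' : 'I_(arity s) -> A) :
    (forall i, [set p : A * A | p.1 = p.2] (a i, a' i)) ->
  [set p : A * A | p.1 = p.2] (interp a, interp a').
Proof. by move=> aa'; congr interp; apply/funext. Qed.

Definition eq_cong A : congruence A :=
  Congruence (eq_cong_equiv A) (@eq_congP A).

Lemma quotient_eq_isomorphic A (theta : congruence A) :
    (forall a a', cong_set theta (a, a') <-> a = a') ->
  isomorphic (quotient theta) A.
Proof. by apply: (quotient_isomorphic (f := hom_id A)) => a; exists a. Qed.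

Definition substructure_incl A (S : set A) (Ssub : subuniverse S) :
    homomorphism (substructure Ssub) A :=
  @Homomorphism Sg (substructure Ssub) A sval (fun _ _ => erefl).

Lemma range_subuniverse A B (f : homomorphism A B) : subuniverse (range f).
Proof.
move=> s b bP.
(* Preimages of all arguments are needed at once, as a function of [i], so mere existence is turned
   into a choice. *)
have {}bP i : {a | f a = b i} by apply: cid; have [a _ <-] := bP i; exists a.
exists (interp (fun i => sval (bP i))) => //; rewrite homP.
by congr interp; apply/funext => i /=; case: (bP i).
Qed.

Arguments range_subuniverse {A B} f.

(** Restricting the codomain of [f] to its range makes it surjective without changing its kernel. *)
Lemma quotient_kernel_isomorphic A B (f : homomorphism A B)
    (theta : congruence A) :
    (forall a a', cong_set theta (a, a') <-> f a = f a') ->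
  isomorphic (quotient theta) (substructure (range_subuniverse f)).
Proof.
move=> fker.
pose g (a : A) : substructure (range_subuniverse f) :=
  exist (fun b => b \in range f) (f a) (mem_set (imageT f a)).
have gP (s : symbol Sg) (a : 'I_(arity s) -> A) :
    g (interp a) = interp (g \o a).
  by apply: eq_exist; rewrite homP.
apply: (quotient_isomorphic (f := Homomorphism gP)) => [[b bP]|a a'].
  have [a _ fab] := set_mem bP.
  by exists a; apply: eq_exist.
by rewrite fker; split=> [faa'|[]//]; apply: eq_exist.
Qed.

End Homomorphisms.

Arguments range_subuniverse {Sg A B} f.

Section Functor.
Variables (Sg : signature) (K : structure Sg -> Prop).

(** Equal sets are included in each other, and antisymmetry of the order takes care of the proof
    components. *)
Lemma Co_eq (A : structure Sg) (theta eta : Co_obj K A) :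
  (theta : set (A * A)) = eta -> theta = eta.
Proof.
move=> te; case: (Co_le_order K A) => _ _; apply; rewrite /Co_le te;
  exact: subset_refl.
Qed.

Hypotheses (Ksub : closed_under_substructures K)
  (Kiso : closed_under_isomorphisms K).

Lemma Co_preimage_quotient (A B : structure Sg) (f : homomorphism A B)
  (theta : congruence B) :
  K (quotient theta) -> K (quotient (preimage_cong f theta)).
Proof.
move=> /Ksub-/(_ _ (range_subuniverse (hom_comp (quotient_hom theta) f))).
(* The image of [A] in [quotient theta] is now in [K]; it remains to see that the kernel of the
   composite is the preimage of [theta]. *)
apply: Kiso; apply/isomorphic_sym/quotient_kernel_isomorphic => a a'.
exact: iff_sym (quotient_projP theta (f a) (f a')).
Qed.

Definition Co_preimage (A B : structure Sg) (f : homomorphism A B) :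
    monotone_map (Co_obj K B) (Co_obj K A) :=
  @MonotoneMap (Co_obj K B) (Co_obj K A)
    (fun theta => CoElt (Co_preimage_quotient f (Co_quotient theta)))
    (fun theta eta le_te p => le_te (f p.1, f p.2)).

Lemma Co_preimage_functor : Co_is_functor K.
Proof.
exists (fun B A f => Co_preimage f); split=> //; split=> [A|C B A g f];
  apply: monotone_map_eq => theta; apply: Co_eq => //=.
(* Composition holds by computation. The identity law is left, as [(p.1, p.2)] becomes [p] only
   after destructing [p]. *)
by apply/seteqP; split=> -[].
Qed.

End Functor.

Theorem proposition3p1 (Sg : signature) (K : structure Sg -> Prop) :
  (closed_under_substructures K -> closed_under_isomorphisms K ->
     Co_is_functor K)
  /\
  (closed_under_isomorphisms K -> Co_is_functor K ->
     closed_under_substructures K).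
Proof.
split; first exact: Co_preimage_functor.
move=> Kiso [F1 [_ F1E]] A S Ssub KA.
have Keq : K (quotient (eq_cong A)).
  by apply: Kiso KA; apply/isomorphic_sym/quotient_eq_isomorphic.
pose theta : Co_obj K A := CoElt Keq.
(* Being an element of [Co_obj K (substructure Ssub)], [eta] carries a proof that its quotient lies
   in [K]. *)
pose eta := F1 A (substructure Ssub) (substructure_incl Ssub) theta.
apply: Kiso (Co_quotient eta); apply: quotient_eq_isomorphic => a a'.
(* By [F1E], [eta] relates elements with the same value in [A]; these coincide, since membership
   proofs are irrelevant. *)
rewrite F1E /=; split=> [|->//]; case: a a' => [a aP] [a' a'P] /= aa'.
exact: eq_exist.
Qed.
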